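(* Let $n$ and $k$ be integers with $0<k<n$, let $\delta_1,\ldots,\delta_n$ be distinct real numbers, let $t\in\mathbb{R}$ and $h>0$, and let $I$ be the smallest closed interval containing all the points $t+\delta_i h$, $1\le i\le n$, that is, $I=\{x:\min_{i}(t+\delta_i h)\le x\le\max_{i}(t+\delta_i h)\}$. Let $f$ be a real-valued function, at least $(n-1)$ times differentiable. If $f$ is $n$-times differentiable on an open set containing $I$, then the error term $$R=-\frac{1}{h^k}\sum_{j=1}^n c_j R_{n,j}$$ is $$R=\frac{(-1)^{n-k}\,h^{n-k}\,k!\,f^{(n)}(t)\,\sigma_{n,n-k}(\delta_1,\ldots,\delta_n)}{n!}+o(h^{n-k}),$$ where the little-oh refers to $h$ approaching zero.
   Context: $(c_1,\ldots,c_n)\in\mathbb{R}^n$ is the unique vector (independent of $h$) satisfying $\sum_{j=1}^n c_j\delta_j^i=0$ for all $0\le i\le n-1$ with $i\ne k$, and $\sum_{j=1}^n c_j\delta_j^k=k!$ (with the convention $\delta^0=1$ for every real $\delta$; existence and uniqueness follow from invertibility of the Vandermonde matrix). $R_{n,j}=f(t+\delta_j h)-\sum_{i=0}^{n-1}f^{(i)}(t)\frac{\delta_j^i h^i}{i!}$ is the remainder in the Taylor expansion of $f$ at $t$. Consequently $R=f^{(k)}(t)-\frac{1}{h^k}\sum_{j=1}^n c_j f(t+\delta_j h)$ is the error of the formula $\frac{1}{h^k}\sum_{j=1}^n c_j f(t+\delta_j h)\approx f^{(k)}(t)$. $\sigma_{n,d}$ denotes the $d$-th elementary symmetric polynomial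 in $n$ variables.
   Formalization: When t lies outside I, the n-th derivative of f at t is additionally assumed to exist; without this f^(n)(t) in the conclusion may be undefined (e.g. f(x)=x^3 sin(1/x), n=2, t=0, delta=1,2). *)

(* Defs.v *)
From HB Require Import structures.
From mathcomp Require Import all_boot all_order all_algebra.
From mathcomp Require Import all_classical all_reals all_analysis.
From mathcomp Require mpoly.

Set Implicit Arguments.
Unset Strict Implicit.
Unset Printing Implicit Defensive.

Import Order.TTheory GRing.Theory Num.Theory numFieldNormedType.Exports.

Local Open Scope ring_scope.
Local Open Scope classical_set_scope.

Section Defs.
Variable R : realType.

(* [derive1n] is total (it returns a junk value where the limit does not
   exist), so the derivatives of all orders up to [m] have to be required. *)
Definition times_differentiable_on (m : nat) (f : R -> R) (D : set R) : Prop :=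
  forall i, (i < m)%N -> forall x, D x -> derivable (f^`(i)) x 1.

(* The defining linear system of the weights; for distinct [delta j] and
   [k < n] it has exactly one solution, its matrix being Vandermonde. *)
Definition fd_weights (n k : nat) (delta c : 'I_n -> R) : Prop :=
  (forall i, (i < n)%N -> i <> k -> \sum_(j < n) c j * delta j ^+ i = 0) /\
  \sum_(j < n) c j * delta j ^+ k = k`!%:R.

Definition taylor_remainder (n : nat) (f : R -> R) (t delta h : R) : R :=
  f (t + delta * h) -
  \sum_(i < n) f^`(i)%classic t * (delta ^+ i * h ^+ i / i`!%:R).

Definition fd_error (n k : nat) (delta c : 'I_n -> R) (f : R -> R) (t h : R)
    : R :=
  - ((h ^+ k)^-1 * \sum_(j < n) c j * taylor_remainder n f t (delta j) h).

Definition node_interval (n : nat) (delta : 'I_n -> R) (t h : R) : set R :=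
  smallest [set J | exists a b : R, J = `[a, b]]
           (range (fun i => t + delta i * h)).

Definition elem_sym (n d : nat) (delta : 'I_n -> R) : R :=
  mpoly.meval delta (mpoly.mesym n R d).

End Defs.

(* Main.v *)
Require Import Defs.
From HB Require Import structures.
From mathcomp Require Import all_boot all_order all_algebra.
From mathcomp Require Import all_classical all_reals all_analysis.
From mathcomp Require Import ring.
From mathcomp Require mpoly.

Set Implicit Arguments.
Unset Strict Implicit.
Unset Printing Implicit Defensive.

Import Order.TTheory GRing.Theory Num.Theory numFieldNormedType.Exports.

Local Open Scope ring_scope.
Local Open Scope classical_set_scope.

(** Up to [o(h^n)], each remainder [R_(n,j)] is the Taylor term of degree [n],
    [f^(n)(t) (delta_j h)^n / n!].  By linearity the
    error is governed by the single moment [\sum_j c_j delta_j^n], the first one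
    that the defining equations of the weights do not give.

    That moment is forced by the others ([fd_weights_moment]).  Each [delta_j] is
    a root of [\prod_i ('X - delta_i)], whose coefficients are, up to sign, the
    elementary symmetric functions of the nodes; hence [delta_j^n] is a fixed
    combination of the lower powers of [delta_j] ([expr_root_elem_sym]).  When
    summed against the weights all these powers vanish except the [k]-th, which
    contributes [k!] and leaves only the factor [sigma_(n,n-k)].

    The analytic input is the Peano form of Taylor's theorem ([taylor_peano]):
    the expansion of order [n] holds up to [o(x^n)] as soon as [f^(n-1)] is
    differentiable at the single point [t].  This pointwise form matters
    because [t] may lie outside the interval spanned by the nodes, and in
    that case [f^(n)] may exist at [t] only.  Dividing the [o(h^n)] by [h^k] gives the
    [o(h^(n-k))] of the result. *)

Definition taylor_poly (R : realType) (f : R -> R) (t : R) (n : nat) : {poly R} :=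
  \poly_(i < n) (f^`(i)%classic t / i`!%:R).

Lemma deriv_taylor_poly (R : realType) (f : R -> R) (t : R) (n : nat) :
  ((taylor_poly f t n.+1)^`())%R = taylor_poly f^`() t n.
Proof.
apply/polyP => i; rewrite coef_deriv !coef_poly ltnS -derive1Sn.
case: ifP => _; last by rewrite mul0rn.
by rewrite -mulrnAr factS natrM invfM -(mulr_natr (_^-1 * _)) mulrAC mulVf ?mul1r.
Qed.

(** The mean value inequality turns a bound [e * |y|^m] on the derivative over
    [|y| <= |x|] into a bound [e * |x|^m * |x|] on the increment. *)
Lemma littleo_primitive (R : realType) (F dF : R -> R) (m : nat) :
  F 0 = 0 -> (\forall x \near (0 : R), is_derive x (1 : R) F (dF x)) ->
  dF =o_ (0 : R) (fun x : R => x ^+ m) ->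
  F =o_ (0 : R) (fun x : R => x ^+ m.+1).
Proof.
move=> F0 dFP /eqoP dFo; apply/eqoP => e e_gt0.
have /nbhs_ballP[r /= r_gt0 rP] : \forall x \near (0 : R),
    is_derive x (1 : R) F (dF x) /\ `|dF x| <= e * `|x ^+ m|.
  by near=> x; split; near: x => //; exact: dFo.
apply/nbhs_ballP; exists r => //= x; rewrite /ball /= sub0r normrN => x_r.
have in_ball y : `|y| <= `|x| -> ball (0 : R) r y.
  by rewrite /ball /= sub0r normrN => /le_lt_trans; apply.
have mvt a b : a <= b -> (forall y, y \in `[a, b]%R -> `|y| <= `|x|) ->
    exists2 y, `|y| <= `|x| & F b - F a = dF y * (b - a).
  move=> a_b abP.
  have FdF y : y \in `[a, b]%R -> is_derive y (1 : R) F (dF y).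
    by move=> /abP/in_ball/rP[].
  have F_cont : {within `[a, b], continuous F}.
    by apply: derivable_within_continuous => y /FdF[].
  have FdF_oo y : y \in `]a, b[%R -> is_derive y (1 : R) F (dF y).
    by move=> /subset_itv_oo_cc/FdF.
  have [y yab Fab] := MVT_segment a_b FdF_oo F_cont.
  by exists y; first exact: abP.
(* The mean value theorem is stated for ordered endpoints, hence the two signs
   of [x]; only absolute values are kept afterwards. *)
have [y y_le Fxy] : exists2 y, `|y| <= `|x| & `|F x| = `|dF y| * `|x|.
  have [x_ge0|/ltW x_le0] := leP 0 x.
  - have [y|y y_le] := mvt _ _ x_ge0.
      by rewrite in_itv /= => /andP[y0 yx]; rewrite !ger0_norm.
    by rewrite F0 !subr0 => ->; exists y; rewrite // normrM.
  - have [y|y y_le] := mvt _ _ x_le0.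
      by rewrite in_itv /= => /andP[y0 yx]; rewrite !ler0_norm // lerN2.
    rewrite F0 !sub0r => FE; exists y => //.
    by rewrite -normrN FE normrM normrN.
have [_ dFy] := rP _ (in_ball _ y_le).
rewrite Fxy exprSr normrM mulrA ler_wpM2r // (le_trans dFy) //.
by rewrite ler_wpM2l ?(ltW e_gt0) // !normrX lerXn2r ?nnegrE.
Unshelve. all: by end_near. Qed.

(** Peano's form of the remainder.  The induction is on the order of
    differentiability, with [f] generalized: the remainder of [f] is a primitive,
    vanishing at 0, of the remainder of [f^`()] at one order less, and the base
    case is the definition of the derivative.  Only the base case looks at the
    top derivative, which is why its existence at [t] alone suffices. *)
Lemma taylor_peano (R : realType) (n : nat) (f : R -> R) (t : R) :
  (\forall x \near t, forall i, (i < n)%N -> derivable f^`(i) x 1) ->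
  derivable f^`(n) t 1 ->
  (fun x => f (t + x) - (taylor_poly f t n.+2).[x])
    =o_ (0 : R) (fun x : R => x ^+ n.+1).
Proof.
elim: n f => [|n IHn] f fP fn.
  apply/eqoP => e e_gt0; have /derivable_nbhsP/eqaddoP := fn.
  move=> /(_ e e_gt0); apply: filterS => x.
  rewrite /= !fctE /= -derive1E /taylor_poly poly_def 2!big_ord_recl big_ord0.
  rewrite !hornerE /= !divr1 addr0 expr1 (addrC t).
  by rewrite -[x%:A]/(x * 1) -[x *: _]/(x * _) mulr1 (mulrC x).
apply: (@littleo_primitive _ _
          (fun x => f^`()%classic (t + x) - (taylor_poly f^`() t n.+2).[x])).
- by rewrite addr0 horner_coef0 coef_poly /= divr1 subrr.
- have : \forall x \near (0 : R), derivable f (t + x) 1.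
    have := fP; rewrite (near_shift 0 t) subr0; apply: filterS => x /= /(_ 0 isT).
    by rewrite addrC.
  apply: filterS => x fx; rewrite -deriv_taylor_poly.
  have dsh : is_derive x (1 : R) (fun y : R => t + y) 1.
    under eq_fun do rewrite addrC; exact: is_derive_shift.
  have dfx : is_derive (t + x) (1 : R) f (f^`()%classic (t + x)).
    by rewrite derive1E; exact: derivableP.
  have := is_derive1_comp dfx dsh; rewrite mulr1 => dfsh.
  exact: is_deriveB dfsh (is_derive_poly _ _).
- apply: IHn; last by rewrite -derive1Sn.
  by apply: filterS fP => x fx i i_n; rewrite -derive1Sn; exact: fx.
Qed.

(** Vieta's formulas for the monic polynomial whose roots are the nodes, used to
    reduce the [n]-th power of a root to lower powers. *)
Lemma expr_root_elem_sym (R : realType) (n : nat) (delta : 'I_n -> R) (j : 'I_n) :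
  delta j ^+ n =
  - \sum_(i < n) (-1) ^+ (n - i) * elem_sym (n - i) delta * delta j ^+ i.
Proof.
pose cs := [tuple delta i | i < n].
pose p : {poly R} := \prod_(x <- cs) ('X - x%:P).
have size_p : size p = n.+1 by rewrite size_prod_XsubC size_tuple.
have p_coef i : (i <= n)%N -> p`_i = (-1) ^+ (n - i) * elem_sym (n - i) delta.
  move=> i_n; have ni : (n - i < n.+1)%N by rewrite ltnS leq_subr.
  have := mpoly.mroots_coeff cs (Ordinal ni); rewrite /= subKn // => ->.
  congr (_ * _); apply: mpoly.meval_eq => l; exact: tnth_mktuple.
have : p.[delta j] = 0.
  by apply/rootP; rewrite root_prod_XsubC; apply/tnthP; exists j; rewrite tnth_mktuple.
rewrite horner_coef size_p big_ord_recr /= p_coef // subnn expr0 mul1r.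
have -> : elem_sym 0 delta = 1 by rewrite /elem_sym mpoly.mesym0E mpoly.meval1.
rewrite mul1r => /eqP; rewrite addrC addr_eq0 => /eqP ->; congr (- _).
by apply: eq_bigr => i _; rewrite p_coef // ltnW.
Qed.

(** Among the powers [delta_j^i], [i < n], given by Vieta's formulas, the weights
    annihilate all but the [k]-th. *)
Lemma fd_weights_moment (R : realType) (n k : nat) (delta c : 'I_n -> R) :
  (k < n)%N -> fd_weights k delta c ->
  \sum_(j < n) c j * delta j ^+ n =
  - ((-1) ^+ (n - k) * k`!%:R * elem_sym (n - k) delta).
Proof.
move=> k_n [c0 ck].
under eq_bigr do rewrite expr_root_elem_sym mulrN mulr_sumr.
rewrite sumrN exchange_big /=; congr (- _).
have inner (i : 'I_n) :
    \sum_(j < n) c j * ((-1) ^+ (n - i) * elem_sym (n - i) delta * delta j ^+ i)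
    = (-1) ^+ (n - i) * elem_sym (n - i) delta * \sum_(j < n) c j * delta j ^+ i.
  by rewrite [RHS]mulr_sumr; apply: eq_bigr => j _; rewrite mulrCA.
rewrite (eq_bigr _ (fun i _ => inner i)) (bigD1 (Ordinal k_n)) //= ck big1 => [|i ik].
  by rewrite addr0 mulrAC.
by rewrite c0 ?mulr0 // => ik'; case/eqP: ik; exact: val_inj.
Qed.

(** The dilation factor may be 0, since a node may be located at [t], so the
    change of variable cannot be inverted; this is also why the constant below
    is [|a|^m + 1] rather than [|a|^m]. *)
Lemma littleo_dilate_at_right (R : realType) (g : R -> R) (a : R) (m : nat) :
  g =o_ (0 : R) (fun x : R => x ^+ m) ->
  (fun h => g (a * h)) =o_ (0^'+) (fun h : R => h ^+ m).
Proof.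
move=> /eqoP go; apply/eqoP => e e_gt0.
have am_gt0 : 0 < `|a| ^+ m + 1 by rewrite ltr_wpDl ?exprn_ge0.
have /= := go _ (divr_gt0 e_gt0 am_gt0).
have ah0 : a * h @[h --> (0 : R)^'+] --> (0 : R).
  apply: cvg_at_right_filter; rewrite -[X in _ --> X](mulr0 a).
  exact: mulrl_continuous.
move=> /ah0 near_ah; near=> h.
have : `|g (a * h)| <= e / (`|a| ^+ m + 1) * `|(a * h) ^+ m| by near: h.
move=> /le_trans; apply.
rewrite exprMn normrM mulrA ler_wpM2r // -mulrA ler_piMr ?(ltW e_gt0) //.
by rewrite mulrC ler_pdivrMr // mul1r normrX lerDl.
Unshelve. all: by end_near. Qed.

(** Rewriting with each hypothesis exhibits the summands as little-o functions,
    whose sums are again recognized as such by canonical structures. *)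
Lemma littleo_sum (K : numFieldType) (V W : normedModType K) (I : finType)
    (T : Type) (F : filter_on T) (G : I -> T -> V) (e : T -> W) :
  (forall i, G i =o_F e) -> (fun x => \sum_i G i x) =o_F e.
Proof.
move=> Go; rewrite -fct_sumE.
elim/big_ind : _ => [|G1 G2 -> ->|i _]; [exact: littleo_eqo..|exact: Go].
Qed.

Theorem theorem2 (R : realType) (n k : nat) (delta c : 'I_n -> R) (t h0 : R)
    (D U : set R) (f : R -> R)
    (k_gt0 : (0 < k)%N) (k_lt_n : (k < n)%N)
    (delta_inj : injective delta)
    (c_weights : fd_weights k delta c)
    (h0_gt0 : 0 < h0)
    (D_open : open D) (D_t : D t)
    (f_diff : times_differentiable_on n.-1 f D)
    (U_open : open U) (U_sub_D : U `<=` D)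
    (I_sub_U : node_interval delta t h0 `<=` U)
    (f_diffn : times_differentiable_on n f U)
    (f_diffn_t : ~ node_interval delta t h0 t -> derivable (f^`(n.-1)) t 1) :
  fd_error k delta c f t =
    (fun h : R => (-1) ^+ (n - k) * h ^+ (n - k) * k`!%:R * f^`(n)%classic t *
                  elem_sym (n - k) delta / n`!%:R)
    +o_ (0^'+) (fun h : R => h ^+ (n - k)).
Proof.
have n_gt0 : (0 < n)%N by exact: leq_trans k_lt_n.
(* [t] need not belong to the interval of the nodes: outside of it the
   differentiability of [f^(n-1)] at [t] is the last hypothesis. *)
have fn_t : derivable f^`(n.-1) t 1.
  have [/I_sub_U Ut|] := pselect (node_interval delta t h0 t); last exact: f_diffn_t.
  by apply: f_diffn => //; rewrite ltn_predL.
have f_near : \forall x \near t, forall i, (i < n.-1)%N -> derivable f^`(i) x 1.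
  near=> x; move=> i i_n; apply: f_diff => //.
  by near: x; exact: open_nbhs_nbhs.
have := taylor_peano f_near fn_t; rewrite prednK //.
set g := (fun x => _) => g_o.
have nf : n`!%:R != 0 :> R by rewrite pnatr_eq0 -lt0n fact_gt0.
have rem_split j h : taylor_remainder n f t (delta j) h =
    f^`(n)%classic t * delta j ^+ n * h ^+ n / n`!%:R + g (delta j * h).
  rewrite /taylor_remainder /g /taylor_poly poly_def big_ord_recr /=.
  rewrite hornerD hornerZ hornerXn horner_sum.
  set s1 := \sum_(i < n) _; set s2 := \sum_(i < n) _.
  have -> : s2 = s1.
    apply: eq_bigr => i _; rewrite hornerZ hornerXn exprMn.
    by rewrite mulrAC !mulrA.
  by rewrite exprMn; field.
have err_split h : 0 < h -> fd_error k delta c f t h =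
    (-1) ^+ (n - k) * h ^+ (n - k) * k`!%:R * f^`(n)%classic t *
      elem_sym (n - k) delta / n`!%:R
    - (h ^+ k)^-1 * \sum_(j < n) c j * g (delta j * h).
  move=> h_gt0; rewrite /fd_error.
  under eq_bigr do rewrite rem_split mulrDr.
  rewrite big_split /= mulrDr opprD; congr (_ - _).
  have -> : \sum_(j < n) c j * (f^`(n)%classic t * delta j ^+ n * h ^+ n / n`!%:R)
     = (\sum_(j < n) c j * delta j ^+ n) * (f^`(n)%classic t * h ^+ n / n`!%:R).
    rewrite mulr_suml; apply: eq_bigr => j _.
    by rewrite -!mulrA; congr (_ * _); rewrite mulrCA.
  rewrite (fd_weights_moment k_lt_n c_weights).
  have -> : h ^+ n = h ^+ (n - k) * h ^+ k by rewrite -exprD subnK // ltnW.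
  have hk : h ^+ k != 0 by rewrite expf_neq0 ?gt_eqF.
  by field; rewrite hk nf.
have sum_o : (fun h => \sum_(j < n) c j * g (delta j * h))
    =o_ (0^'+) (fun h : R => h ^+ n).
  apply: littleo_sum => j; have gj := littleo_dilate_at_right (delta j) g_o.
  by rewrite (_ : (fun h => _) = c j *: (fun h => g (delta j * h))) // gj scaleo.
apply/eqaddoP => e e_gt0.
have /eqoP/(_ e e_gt0) sum_le := sum_o.
near=> h.
have h_gt0 : 0 < h by near: h; exact: nbhs_right_gt.
rewrite !fctE err_split // addrAC subrr add0r normrN normrM.
rewrite normfV ler_pdivrMl ?normr_gt0 ?expf_neq0 ?gt_eqF //.
rewrite mulrCA -normrM -exprD subnKC ?(ltnW k_lt_n) //.
by near: h.
Unshelve. all: by end_near. Qed.
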